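(* For every integer $n\geq 5$ there exists a metabelian Lie ring $L(n)$ such that $\gamma_n(L(n))=0$ and $\delta_{2n-4}(L(n))\neq 0$.
   Context: A Lie ring is a Lie algebra over the ring $\mathbb{Z}$ of integers (an abelian group with a biadditive bracket satisfying $[x,x]=0$ and the Jacobi identity). For additive subgroups $A,B$ of a Lie ring $L$, $[A,B]$ denotes the additive subgroup generated by all $[a,b]$ with $a\in A$, $b\in B$. The derived subring is $L'=[L,L]$, the second derived subring is $L''=[L',L']$, and $L$ is metabelian if $L''=0$. The lower central series of $L$ is defined by $\gamma_1(L)=L$ and $\gamma_{n+1}(L)=[L,\gamma_n(L)]$ for $n\geq 1$. Let $\mathcal{U}(L)$ be the universal enveloping algebra of $L$ over $\mathbb{Z}$, and let $L$ be regarded as embedded in $\mathcal{U}(L)$ via the canonical map (which is injective for Lie rings over $\mathbb{Z}$). The augmentation ideal $\varpi(L)$ is the two-sided ideal of $\mathcal{U}(L)$ generated by $L$, and $\varpi^n(L)$ is its $n$-th power. The Lie dimension series is $\delta_n(L)=L\cap\varpi^n(L)$, $n\geq 1$. *)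

(* Defs.v *)
From HB Require Import structures.
From mathcomp Require Import all_boot all_algebra.
From mathcomp Require Import generic_quotient ring_quotient.
From mathcomp Require Import boolp classical_sets.
From mathcomp Require Import monalg.

Set Implicit Arguments.
Unset Strict Implicit.
Unset Printing Implicit Defensive.

Import GRing.Theory.

Local Open Scope ring_scope.
Local Open Scope classical_set_scope.
Local Open Scope quotient_scope.

HB.mixin Record Zmodule_isLieRing L of GRing.Zmodule L := {
  lie : L -> L -> L;
  lieDl : left_distributive lie +%R;
  lieDr : right_distributive lie +%R;
  liexx : forall x, lie x x = 0;
  lie_jacobi : forall x y z,
    lie x (lie y z) + lie y (lie z x) + lie z (lie x y) = 0
}.

#[short(type="lieRingType")]
HB.structure Definition LieRing := { L of Zmodule_isLieRing L & GRing.Zmodule L }.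

Definition zspan (V : zmodType) (S : set V) : set V :=
  smallest (fun A : set V => zmod_closed [in A]) S.

Section LieRingSeries.
Variable L : lieRingType.
Implicit Types A B : set L.

Definition lie_prod A B : set L := zspan [set lie a b | a in A & b in B].

Definition derived : set L := lie_prod [set: L] [set: L].

Definition metabelian : Prop := lie_prod derived derived = [set 0].

(* gamma_1 = L; the value at index 0 is a placeholder. *)
Fixpoint lower_central (n : nat) : set L :=
  match n with
  | 0%N | 1%N => [set: L]
  | m.+1 => lie_prod [set: L] (lower_central m)
  end.

End LieRingSeries.

Arguments derived L : clear implicits.
Arguments metabelian L : clear implicits.
Arguments lower_central L n : clear implicits.

Section Ideals.
Variable R : pzRingType.
Implicit Types I J S : set R.

Definition two_sided_ideal I : Prop :=
  zmod_closed [in I] /\ forall a x, I x -> I (a * x) /\ I (x * a).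

Definition ideal_gen S : set R := smallest two_sided_ideal S.

Definition ideal_mul I J : set R := zspan [set a * b | a in I & b in J].

Fixpoint ideal_exp I (n : nat) : set R :=
  if n is m.+1 then ideal_mul I (ideal_exp I m) else [set: R].

Lemma ideal_gen_ideal S : two_sided_ideal (ideal_gen S).
Proof.
split; last first.
  by move=> a x Ix; split=> A AP; have [] := AP => -[_ Am] _;
    have [] := Am a x (Ix _ AP).
split; first by apply/mem_set => A [[[/set_mem A0 _] _] _].
move=> x y /set_mem Ix /set_mem Iy; apply/mem_set => A AP.
have [[[_ AB] _] _] := AP.
by apply: set_mem; apply: AB; apply/mem_set; [apply: Ix|apply: Iy].
Qed.

End Ideals.

(* The universal enveloping ring of L: the free associative ring Z<L> on the
   underlying set of L, modulo the two-sided ideal that makes the generators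
   additive in L and turns the Lie bracket into the commutator. *)
Section Enveloping.
Variable L : lieRingType.

Local Notation free_ring := {malg int[{fmonom L}]}.

Definition free_gen (x : L) : free_ring := mkmalgU (fmu x) 1.

Definition env_relators : set free_ring :=
  [set free_gen (x + y) - (free_gen x + free_gen y) | x in [set: L] & y in [set: L]]
  `|` [set free_gen (lie x y) - (free_gen x * free_gen y - free_gen y * free_gen x)
       | x in [set: L] & y in [set: L]].

Definition env_ideal : {pred free_ring} := [in ideal_gen env_relators].

Lemma env_ideal_zmod_closed : zmod_closed env_ideal.
Proof. by have [] := ideal_gen_ideal env_relators. Qed.

HB.instance Definition _ :=
  GRing.isZmodClosed.Build free_ring env_ideal env_ideal_zmod_closed.

Lemma env_idealMl a x : x \in env_ideal -> a * x \in env_ideal.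
Proof.
move=> /set_mem Ix; apply/mem_set.
by have [_ /(_ a x Ix)[]] := ideal_gen_ideal env_relators.
Qed.

Lemma env_idealMr a x : x \in env_ideal -> x * a \in env_ideal.
Proof.
move=> /set_mem Ix; apply/mem_set.
by have [_ /(_ a x Ix)[]] := ideal_gen_ideal env_relators.
Qed.

Definition enveloping := {ideal_quot env_ideal}.
HB.instance Definition _ := GRing.Zmodule.on enveloping.

Definition env_pi (p : free_ring) : enveloping := \pi_({ideal_quot env_ideal}) p.
Definition env_one : enveloping := env_pi 1.
Definition env_mul (u v : enveloping) : enveloping :=
  env_pi (repr (u : {ideal_quot env_ideal}) * repr (v : {ideal_quot env_ideal})).

Lemma env_piP p q : env_pi p = env_pi q <-> p - q \in env_ideal.
Proof. by rewrite Quotient.idealrBE; split=> [/eqP|/eqP]. Qed.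

Lemma env_reprK u : env_pi (repr (u : {ideal_quot env_ideal})) = u.
Proof. exact: reprK. Qed.

Lemma env_piD : {morph env_pi : p q / p + q}.
Proof. by move=> p q; rewrite /env_pi; exact: pi_addr. Qed.

Lemma env_piM p q : env_pi (p * q) = env_mul (env_pi p) (env_pi q).
Proof.
apply/env_piP; set p' := repr _; set q' := repr _.
have hp : p - p' \in env_ideal by apply/env_piP; rewrite env_reprK.
have hq : q - q' \in env_ideal by apply/env_piP; rewrite env_reprK.
rewrite -[p * q](subrK (p * q')) -mulrBr -addrA -mulrBl.
by apply: rpredD; [apply: env_idealMl|apply: env_idealMr].
Qed.

Lemma env_mulA : associative env_mul.
Proof.
move=> u v w; rewrite -[u]env_reprK -[v]env_reprK -[w]env_reprK.
by rewrite -!env_piM mulrA.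
Qed.

Lemma env_mul1 : left_id env_one env_mul.
Proof. by move=> u; rewrite -[u]env_reprK -env_piM mul1r. Qed.

Lemma env_mulr1 : right_id env_one env_mul.
Proof. by move=> u; rewrite -[u]env_reprK -env_piM mulr1. Qed.

Lemma env_mulDl : left_distributive env_mul +%R.
Proof.
move=> u v w; rewrite -[u]env_reprK -[v]env_reprK -[w]env_reprK.
by rewrite -env_piD -!env_piM -env_piD mulrDl.
Qed.

Lemma env_mulDr : right_distributive env_mul +%R.
Proof.
move=> u v w; rewrite -[u]env_reprK -[v]env_reprK -[w]env_reprK.
by rewrite -env_piD -!env_piM -env_piD mulrDr.
Qed.

HB.instance Definition _ := GRing.Zmodule_isPzRing.Build enveloping
  env_mulA env_mul1 env_mulr1 env_mulDl env_mulDr.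

Definition env_inj (x : L) : enveloping := env_pi (free_gen x).

Lemma env_relatorP p q : env_relators (p - q) -> env_pi p = env_pi q.
Proof. by move=> relpq; apply/env_piP/mem_set => A [_]; apply. Qed.

Lemma env_injD x y : env_inj (x + y) = env_inj x + env_inj y.
Proof. by rewrite -env_piD; apply: env_relatorP; left; exists x => //; exists y. Qed.

Lemma env_inj_lie x y :
  env_inj (lie x y) = env_inj x * env_inj y - env_inj y * env_inj x.
Proof.
apply: (canRL (addrK _)).
rewrite -[_ * _ in LHS]env_piM -[_ * _ in RHS]env_piM -env_piD.
apply: env_relatorP; right; exists x => //; exists y => //.
by rewrite opprB addrA.
Qed.

Definition augmentation_ideal : set enveloping := ideal_gen (range env_inj).

(* L is identified with its image under env_inj, so that the intersection of L
   with a subset of U(L) is a preimage. *)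
Definition lie_dim (n : nat) : set L :=
  env_inj @^-1` ideal_exp augmentation_ideal n.

End Enveloping.

Arguments augmentation_ideal L : clear implicits.
Arguments lie_dim L n : clear implicits.

(* Main.v *)
Require Import Defs.
From HB Require Import structures.
From mathcomp Require Import all_boot all_algebra.
From mathcomp Require Import zify.
From mathcomp Require Import boolp classical_sets.

(** A Lie version of Rips' example. Let [a2 *+ e2 = u2] and [a3 *+ e3 = u3] with [u2]
    and [u3] in gamma_(n-2). Expanding the commutators in U(L) gives
      i [a1,a2] + j [a1,a3] + k [a2,a3]
        = a1 (i a2 + j a3) + a2 (k a3 - i a1) + a3 (- j a1 - k a2),
    so if the three right-hand factors are 0, [v2 *+ e2] and [v3 *+ e3] with [v2] and
    [v3] in gamma_(n-2), the element is [u2 * v2 + u3 * v3], which lies in the power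
    2(n-2) of the augmentation ideal.

    Such a configuration with nonzero element, (i, j, k) = (128, 64, 32) and
    (e2, e3) = (16, 4), exists in the Heisenberg-like Lie ring W + C given by an
    alternating form on W = (Z/256)^2 + (Z/16)^2 with values in C = Z/256; the [u]'s
    and [v]'s span an isotropic subgroup iota(Y). To push iota(Y) deep into the lower
    central series, add an element t and a thread of copies of Y and of C which [t, -]
    shifts down until they reach iota(Y) and C. *)

Set Implicit Arguments.
Unset Strict Implicit.
Unset Printing Implicit Defensive.

Import GRing.Theory.

(** * Additive spans and powers of a two-sided ideal *)

Section Spans.
Local Open Scope ring_scope.
Local Open Scope classical_set_scope.

(** Serves as the induction principle for [zspan]: a property defining a subgroup is checked on
    generators only. *)
Lemma zspan_sub (V : zmodType) (S A : set V) :
  zmod_closed [in A] -> S `<=` A -> zspan S `<=` A.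
Proof. by move=> A_zmod SA x; apply. Qed.

Lemma sub_zspan (V : zmodType) (S : set V) : S `<=` zspan S.
Proof. by move=> x Sx A [_]; apply. Qed.

Lemma zspan_zmod_closed (V : zmodType) (S : set V) : zmod_closed [in zspan S].
Proof.
split; first by apply/mem_set => A [[/set_mem]].
move=> x y /set_mem Sx /set_mem Sy; apply/mem_set => A [A_zmod SA].
apply/set_mem; apply: A_zmod.2; apply/mem_set; [exact: Sx|exact: Sy].
Qed.

Lemma zspan_set1 (V : zmodType) (S : set V) : S `<=` [set 0] -> zspan S = [set 0].
Proof.
move=> S0; apply/seteqP; split=> [|_ ->]; last first.
  by apply/set_mem; have [] := zspan_zmod_closed S.
apply: zspan_sub => //; split=> [|x y /set_mem -> /set_mem ->]; apply/mem_set => //.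
by rewrite subrr.
Qed.

Variables (R : pzRingType) (I : set R).
Hypothesis idI : two_sided_ideal I.

Lemma ideal_exp_zmod_closed k : zmod_closed [in ideal_exp I k].
Proof. by case: k => [|k]; [split=> [|x y _ _]; exact/mem_set | exact: zspan_zmod_closed]. Qed.

Lemma ideal_expMl k a x : ideal_exp I k x -> ideal_exp I k (a * x).
Proof.
case: k => [//|k] Ix.
pose A := [set x | ideal_exp I k.+1 (a * x)].
have [E0 EB] := ideal_exp_zmod_closed k.+1.
apply: (@zspan_sub _ _ A) Ix => [|_ [b Ib [c Ic <-]]].
  split=> [|u v /set_mem Au /set_mem Av]; apply/mem_set; rewrite /A /=.
    by rewrite mulr0; apply/set_mem.
  by rewrite mulrBr; apply/set_mem; apply: EB; apply/mem_set.
rewrite /A /= mulrA; apply: sub_zspan; exists (a * b); last by exists c.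
by have [_ /(_ a b Ib)[]] := idI.
Qed.

(** Induction on [j] peels off the leading factor from [I]. At [j = 0] the power is the whole ring,
    and the claim is that powers of [I] are left ideals. *)
Lemma ideal_expM j k x y :
  ideal_exp I j x -> ideal_exp I k y -> ideal_exp I (j + k) (x * y).
Proof.
move=> + Iy; elim: j x => [|j IHj] x Ix; first exact: ideal_expMl.
pose A := [set x | ideal_exp I (j.+1 + k) (x * y)].
have [E0 EB] := ideal_exp_zmod_closed (j.+1 + k).
apply: (@zspan_sub _ _ A) Ix => [|_ [b Ib [c Ic <-]]].
  split=> [|u v /set_mem Au /set_mem Av]; apply/mem_set; rewrite /A /=.
    by rewrite mul0r; apply/set_mem.
  by rewrite mulrBl; apply/set_mem; apply: EB; apply/mem_set.
rewrite /A /= -mulrA; apply: sub_zspan; exists b => //; exists (c * y) => //.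
exact: IHj.
Qed.

Lemma ideal_exp1 x : I x -> ideal_exp I 1 x.
Proof. by move=> Ix; apply: sub_zspan; exists x => //; exists 1; rewrite ?mulr1. Qed.

End Spans.

(** * Finite sequences extended by zero *)

Section FinfunEntries.
Local Open Scope ring_scope.
Variables (V : zmodType) (k : nat).
Implicit Types f g : {ffun 'I_k -> V}.

(** The default 0 beyond the range lets shift formulas hold at every index, including the last
    one. *)
Definition fentry f (j : nat) : V := oapp f 0 (insub j).

Lemma fentry_finfun (F : nat -> V) j :
  fentry [ffun i : 'I_k => F i] j = if (j < k)%N then F j else 0.
Proof. by rewrite /fentry; case: insubP => [i -> <-|/negbTE->] //=; rewrite ffunE. Qed.

Lemma fentry_out f j : (k <= j)%N -> fentry f j = 0.
Proof. by rewrite /fentry leqNgt => kj; rewrite insubN. Qed.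

Lemma fentryB f g j : fentry (f - g) j = fentry f j - fentry g j.
Proof. by rewrite /fentry; case: insubP => [i _ _|_] /=; rewrite ?subr0 // !ffunE. Qed.

Lemma fentryD f g j : fentry (f + g) j = fentry f j + fentry g j.
Proof. by rewrite /fentry; case: insubP => [i _ _|_] /=; rewrite ?addr0 // !ffunE. Qed.

Lemma eq_fentry f g : (forall j, fentry f j = fentry g j) -> f = g.
Proof.
by move=> fg; apply/ffunP => i; have := fg i; rewrite /fentry valK.
Qed.

End FinfunEntries.

(** * The thread Lie ring *)

Section Thread.
Local Open Scope ring_scope.
Variables (W Y C : zmodType) (om : W -> {additive W -> C}) (iota : {additive Y -> W}).
Hypotheses (omDl : forall u v w, om (u + v) w = om u w + om v w)
  (omww : forall w, om w w = 0)
  (om_iota : forall y y', om (iota y) (iota y') = 0).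
Variable m : nat.

(** The factor [int] is spanned by t. There is one more copy of [C] than of [Y] because a bracket of
    [W] with the copy j of [Y] lands in the copy j+1 of [C]. *)
Definition thread : Type := int * W * {ffun 'I_m -> Y} * {ffun 'I_m.+1 -> C}.
HB.instance Definition _ := GRing.Zmodule.on thread.
Implicit Types p q r : thread.

Definition tc p : int := p.1.1.1.
Definition wc p : W := p.1.1.2.
Definition yc p : nat -> Y := fentry p.1.2.
Definition zc p : nat -> C := fentry p.2.

Definition mk_thread (t : int) (w : W) (y : nat -> Y) (z : nat -> C) : thread :=
  (t, w, [ffun i : 'I_m => y i], [ffun i : 'I_m.+1 => z i]).

Lemma thread_eq p q :
  tc p = tc q -> wc p = wc q -> yc p =1 yc q -> zc p =1 zc q -> p = q.
Proof.
case: p q => [[[t w] y] z] [[[t' w'] y'] z']; rewrite /tc /wc /yc /zc /=.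
by move=> -> -> /eq_fentry-> /eq_fentry->.
Qed.

Lemma tcD p q : tc (p + q) = tc p + tc q. Proof. by []. Qed.
Lemma wcD p q : wc (p + q) = wc p + wc q. Proof. by []. Qed.
Lemma ycD p q j : yc (p + q) j = yc p j + yc q j. Proof. exact: (fentryD p.1.2 q.1.2). Qed.
Lemma zcD p q j : zc (p + q) j = zc p j + zc q j. Proof. exact: (fentryD p.2 q.2). Qed.
Lemma tcB p q : tc (p - q) = tc p - tc q. Proof. by []. Qed.
Lemma wcB p q : wc (p - q) = wc p - wc q. Proof. by []. Qed.
Lemma ycB p q j : yc (p - q) j = yc p j - yc q j. Proof. exact: (fentryB p.1.2 q.1.2). Qed.
Lemma zcB p q j : zc (p - q) j = zc p j - zc q j. Proof. exact: (fentryB p.2 q.2). Qed.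
Lemma yc0 j : yc 0 j = 0. Proof. by rewrite -(subrr (0 : thread)) ycB subrr. Qed.
Lemma zc0 j : zc 0 j = 0. Proof. by rewrite -(subrr (0 : thread)) zcB subrr. Qed.

Lemma om0l w : om 0 w = 0.
Proof. by apply: (addrI (om 0 w)); rewrite -omDl !addr0. Qed.

Lemma omC u v : om u v = - om v u.
Proof.
have := omww (u + v); rewrite omDl !raddfD /= !omww add0r addr0.
by move=> /eqP; rewrite addr_eq0 => /eqP.
Qed.
(* Indices count the shifts left before [iota Y] or the bottom copy of [C] is reached:
   [t, y_(j+1)] = y_j, [t, y_0] = iota y, [t, z_(j+1)] = z_j,
   [w, y_j] = (om w (iota y))_(j+1) and [w, w'] = (om w w')_0. *)
Definition thread_lie p q : thread := mk_thread 0
  (iota (yc q 0 *~ tc p - yc p 0 *~ tc q))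
  (fun j => yc q j.+1 *~ tc p - yc p j.+1 *~ tc q)
  (fun j => (if j is i.+1 then om (wc p) (iota (yc q i)) - om (wc q) (iota (yc p i))
             else om (wc p) (wc q)) + (zc q j.+1 *~ tc p - zc p j.+1 *~ tc q)).

Lemma tc_lie p q : tc (thread_lie p q) = 0. Proof. by []. Qed.

Lemma wc_lie p q :
  wc (thread_lie p q) = iota (yc q 0 *~ tc p - yc p 0 *~ tc q).
Proof. by []. Qed.

Lemma yc_lie p q j :
  yc (thread_lie p q) j = yc q j.+1 *~ tc p - yc p j.+1 *~ tc q.
Proof.
rewrite /yc fentry_finfun; case: ltnP => // mj.
by rewrite !fentry_out ?(leq_trans mj) // !mul0rz subrr.
Qed.

Lemma zc_lie0 p q : zc (thread_lie p q) 0 =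
  om (wc p) (wc q) + (zc q 1 *~ tc p - zc p 1 *~ tc q).
Proof. by rewrite /zc fentry_finfun. Qed.

Lemma zc_lieS p q j : zc (thread_lie p q) j.+1 =
  om (wc p) (iota (yc q j)) - om (wc q) (iota (yc p j))
    + (zc q j.+2 *~ tc p - zc p j.+2 *~ tc q).
Proof.
rewrite /zc fentry_finfun; case: ltnP => // mj.
by rewrite /yc !fentry_out ?(leq_trans mj) // !mul0rz !raddf0 !addr0.
Qed.

Definition lieE := (tc_lie, wc_lie, yc_lie, zc_lie0, zc_lieS).

(** The shift part of each component of [thread_lie] has the form [b *~ t - a *~ u]; this lemma and
    the next two are the Lie identities for that expression. *)
Lemma mulrz_lieDl (V : zmodType) (a b c : V) (t u v : int) :
  c *~ (t + u) - (a + b) *~ v = (c *~ t - a *~ v) + (c *~ u - b *~ v).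
Proof. by rewrite mulrzDr mulrzDl opprD addrACA. Qed.

Lemma mulrz_lieC (V : zmodType) (a b : V) (t u : int) :
  b *~ t - a *~ u = - (a *~ u - b *~ t).
Proof. by rewrite opprB. Qed.

Lemma mulrz_jacobi (V : zmodType) (a b c : V) (s t u : int) :
  (c *~ t - b *~ u) *~ s + (a *~ u - c *~ s) *~ t + (b *~ s - a *~ t) *~ u = 0.
Proof.
rewrite !mulrzBl -!mulrzA [(u * s)%R]mulrC [(t * s)%R]mulrC [(u * t)%R]mulrC.
by rewrite [X in X + _]addrC !addrA !subrK subrr.
Qed.

Lemma thread_lieC p q : thread_lie p q = - thread_lie q p.
Proof.
apply/eqP; rewrite -addr_eq0; apply/eqP; apply: thread_eq => [//||j|[|j]].
- by rewrite wcD !lieE -raddfD mulrz_lieC addNr raddf0.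
- by rewrite ycD !lieE mulrz_lieC addNr yc0.
- by rewrite zcD !lieE mulrz_lieC [om (wc p) _]omC addrACA !addNr add0r zc0.
- rewrite zcD !lieE mulrz_lieC -[om _ _ - om _ _ in X in X + _]opprB.
  by rewrite addrACA !addNr add0r zc0.
Qed.

Lemma thread_lieDl : left_distributive thread_lie +%R.
Proof.
move=> p q r; apply: thread_eq => [//||j|[|j]].
- by rewrite wcD !lieE -raddfD tcD ycD mulrz_lieDl.
- by rewrite ycD !lieE tcD ycD mulrz_lieDl.
- by rewrite zcD !lieE tcD wcD zcD omDl mulrz_lieDl addrACA.
- rewrite zcD !lieE tcD wcD zcD ycD omDl mulrz_lieDl !raddfD /=.
  by rewrite [RHS]addrACA; congr (_ + _); rewrite addrACA.
Qed.

Lemma thread_lieDr : right_distributive thread_lie +%R.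
Proof.
by move=> p q r; rewrite thread_lieC thread_lieDl opprD -!thread_lieC.
Qed.

Lemma thread_liexx p : thread_lie p p = 0.
Proof.
apply: thread_eq => [//||j|[|j]].
- by rewrite !lieE subrr raddf0.
- by rewrite !lieE subrr yc0.
- by rewrite !lieE !subrr omww addr0 zc0.
- by rewrite !lieE !subrr addr0 zc0.
Qed.

Lemma jacobi6 (V : zmodType) (a b c d e f : V) :
  (a - b) + (c - d) + ((e - c) + (f - a)) + ((d - f) + (b - e)) = 0.
Proof.
by rewrite [LHS](AC (2*2*2) (4*1*6*3*2*5)) /= !addrA !subrK subrr.
Qed.

Lemma mulrz_split3 (V : zmodType) (a1 a2 a3 b1 b2 b3 c1 c2 c3 : V) (s t u : int) :
  (a1 + (b1 + c1) *~ s) + (a2 + (b2 + c2) *~ t) + (a3 + (b3 + c3) *~ u)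
  = (a1 + b1 *~ s) + (a2 + b2 *~ t) + (a3 + b3 *~ u)
    + (c1 *~ s + c2 *~ t + c3 *~ u).
Proof.
by rewrite !mulrzDl !addrA [LHS](ACl (1*2*4*5*7*8*3*6*9)).
Qed.

(** The shift parts cancel by [mulrz_jacobi]. What remains in a [C]-component is six values of [om],
    each occurring with both signs. In components j+1 the terms pairing the [W]-part of an inner
    bracket with [iota] of an entry vanish, since that part lies in the isotropic image of
    [iota]. *)
Lemma thread_jacobi p q r :
  thread_lie p (thread_lie q r) + thread_lie q (thread_lie r p)
    + thread_lie r (thread_lie p q) = 0.
Proof.
apply: thread_eq => [//||j|[|j]].
- rewrite !wcD !lieE /= !mulr0z !subr0 -!raddfD.
  by rewrite mulrz_jacobi raddf0.
- by rewrite !ycD !lieE /= !mulr0z !subr0 mulrz_jacobi yc0.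
- rewrite !zcD !lieE /= !mulr0z !subr0 mulrz_split3 mulrz_jacobi addr0.
  by rewrite !raddfB /= !(raddfMz iota) !(raddfMz (om _)) !mulrzBl jacobi6 zc0.
- rewrite !zcD !lieE /= !om_iota !mulr0z !subr0 mulrz_split3 mulrz_jacobi addr0.
  by rewrite !raddfB /= !(raddfMz iota) !(raddfMz (om _)) !mulrzBl jacobi6 zc0.
Qed.

Definition thread_ring : lieRingType :=
  HB.pack thread (Zmodule_isLieRing.Build thread
    thread_lieDl thread_lieDr thread_liexx thread_jacobi).

End Thread.

(** * Rips' element in powers of the augmentation ideal *)

Lemma commutators_collect (R : pzRingType) (a b c : R) i j k :
  ((a * b - b * a) *+ i + (a * c - c * a) *+ j + (b * c - c * b) *+ k
  = a * (b *+ i + c *+ j) + b * (c *+ k - a *+ i) + c * (- (a *+ j) - b *+ k))%R.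
Proof.
rewrite !mulrDr !mulrN !mulrnAr !mulrnBl !addrA.
by rewrite [LHS](ACl (1*3*5*2*4*6)).
Qed.

Section LieDimension.
Local Open Scope ring_scope.
Variable L : lieRingType.
Implicit Types (x y : L) (j k : nat).

Lemma env_inj_is_zmod_morphism : zmod_morphism (@env_inj L).
Proof.
by move=> x y; apply: (addIr (env_inj y)); rewrite -env_injD !subrK.
Qed.

HB.instance Definition _ :=
  GRing.isZmodMorphism.Build L (enveloping L) (@env_inj L) env_inj_is_zmod_morphism.

Let idA : two_sided_ideal (augmentation_ideal L) := ideal_gen_ideal _.

Lemma lie_dim1 x : lie_dim L 1 x.
Proof. by apply: (ideal_exp1 (I := augmentation_ideal L)) => A [_]; apply; exists x. Qed.

Lemma lie_dim_lie j k x y :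
  lie_dim L j x -> lie_dim L k y -> lie_dim L (j + k) (lie x y).
Proof.
move=> Ix Iy; rewrite /lie_dim /= env_inj_lie; apply: set_mem.
apply: (ideal_exp_zmod_closed _ _).2; apply: mem_set.
  exact: ideal_expM.
by rewrite addnC; apply: ideal_expM.
Qed.

Lemma lie_dim_rips d i j k e2 e3 (a1 a2 a3 v2 v3 : L) :
    a2 *+ i + a3 *+ j = 0 ->
    a3 *+ k - a1 *+ i = v2 *+ e2 ->
    - (a1 *+ j) - a2 *+ k = v3 *+ e3 ->
    lie_dim L d (a2 *+ e2) -> lie_dim L d (a3 *+ e3) ->
    lie_dim L d v2 -> lie_dim L d v3 ->
  lie_dim L (d + d) (lie a1 a2 *+ i + lie a1 a3 *+ j + lie a2 a3 *+ k).
Proof.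
move=> w1 w2 w3 Ia2 Ia3 Iv2 Iv3; rewrite /lie_dim /=.
suff -> : env_inj (lie a1 a2 *+ i + lie a1 a3 *+ j + lie a2 a3 *+ k)
    = env_inj (a2 *+ e2) * env_inj v2 + env_inj (a3 *+ e3) * env_inj v3.
  have E := ideal_exp_zmod_closed (augmentation_ideal L) (d + d).
  by apply: set_mem; apply: (GRing.zmod_closedD E).2; apply: mem_set;
    exact: ideal_expM.
(* The multiple [e2] moves across the product from [a2] to [v2], where [w2] absorbs it. *)
have -> : env_inj (a2 *+ e2) * env_inj v2 = env_inj a2 * env_inj (a3 *+ k - a1 *+ i).
  by rewrite w2 !raddfMn /= mulrnAl mulrnAr.
have -> : env_inj (a3 *+ e3) * env_inj v3
    = env_inj a3 * env_inj (- (a1 *+ j) - a2 *+ k).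
  by rewrite w3 !raddfMn /= mulrnAl mulrnAr.
have w1E : env_inj a1 * env_inj (a2 *+ i + a3 *+ j) = 0.
  by rewrite w1 raddf0 mulr0.
(* The zero product [w1E] is put back to obtain all three terms of [commutators_collect]. *)
rewrite -[RHS]add0r -[X in _ = X + _]w1E !raddfD /= !raddfN !(raddfMn (@env_inj L)) /=.
by rewrite !env_inj_lie commutators_collect addrA.
Qed.

End LieDimension.

(** * Lower central and dimension series of the thread ring *)

Section ThreadSeries.
Local Open Scope ring_scope.
Local Open Scope classical_set_scope.
Variables (W Y C : zmodType) (om : W -> {additive W -> C}) (iota : {additive Y -> W}).
Hypotheses (omDl : forall u v w, om (u + v) w = om u w + om v w)
  (omww : forall w, om w w = 0)
  (om_iota : forall y y', om (iota y) (iota y') = 0).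
Variable m : nat.
Local Notation L := (thread_ring omDl omww om_iota m).
Implicit Types p q : L.

Lemma lie_threadE p q : lie p q = thread_lie om iota p q. Proof. by []. Qed.

(* Weights: [wc] values in the image of [iota] have weight m+1, the entries
   [yc _ j] weight m-j, and [zc _ j] weight m+2-j. *)
Definition layer k : set L := [set p | [/\ tc p = 0, exists y, wc p = iota y,
  ((m.+1 < k)%N -> wc p = 0), (forall j, (m < k + j)%N -> yc p j = 0) &
  (forall j, (m.+2 < k + j)%N -> zc p j = 0)]].

Lemma layer_zmod_closed k : zmod_closed [in layer k].
Proof.
split=> [|p q /set_mem[t1 [y1 w1] v1 c1 d1] /set_mem[t2 [y2 w2] v2 c2 d2]]; apply/mem_set; split.
- by [].
- by exists 0; rewrite raddf0.
- by [].
- by move=> j _; rewrite yc0.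
- by move=> j _; rewrite zc0.
- by rewrite tcB t1 t2 subr0.
- by exists (y1 - y2); rewrite wcB w1 w2 raddfB.
- by move=> mk; rewrite wcB v1 ?v2 ?subr0.
- by move=> j mk; rewrite ycB c1 ?c2 ?subr0.
- by move=> j mk; rewrite zcB d1 ?d2 ?subr0.
Qed.

Lemma layer2_lie p q : layer 2 (lie p q).
Proof.
split=> [||mk|j mj|j mj]; rewrite lie_threadE.
- by [].
- by eexists; rewrite wc_lie.
(* With [m = 0] there is no copy of [Y], so the [W]-part of a bracket is [iota 0]. *)
- have m0 : m = 0%N by lia.
  by rewrite wc_lie /yc !fentry_out ?m0 // !mul0rz subrr raddf0.
- by rewrite yc_lie /yc !fentry_out ?mul0rz ?subrr //; lia.
- by rewrite /zc fentry_out //; lia.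
Qed.

(** Each bracket raises the weight: t lowers indices by one, and [W] sends [yc _ j] of weight m-j to
    [zc _ j.+1] of weight m+1-j. Pairings of [wc q] with [iota] of entries of [p] vanish by
    isotropy. *)
Lemma layerS_lie k p q : (1 < k)%N -> layer k q -> layer k.+1 (lie p q).
Proof.
move=> k1 [tq [y wq] wq0 yq zq].
split=> [||mk|j mj|[|j] mj]; rewrite lie_threadE.
- by [].
- by eexists; rewrite wc_lie.
- by rewrite wc_lie tq yq ?mul0rz ?mulr0z ?subrr ?raddf0 //; lia.
- by rewrite yc_lie tq yq ?mul0rz ?mulr0z ?subrr //; lia.
- by rewrite zc_lie0 // wq0 ?zq ?tq ?raddf0 ?mul0rz ?mulr0z ?subrr ?addr0 //; lia.
- rewrite zc_lieS // yq ?zq ?tq ?wq ?om_iota; try lia.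
  by rewrite mul0rz mulr0z !raddf0 !addr0.
Qed.

Lemma lower_central_thread k : (1 < k)%N -> lower_central L k `<=` layer k.
Proof.
case: k => [//|[//|k] _]; elim: k => [|k IHk].
  by apply: (zspan_sub (layer_zmod_closed 2)) => _ [p _ [q _ <-]]; apply: layer2_lie.
apply: (zspan_sub (layer_zmod_closed k.+3)) => _ [p _ [q Lq <-]].
by apply: layerS_lie; last exact: IHk.
Qed.

(** No weight exceeds m+2, the weight of [zc _ 0]. *)
Lemma thread_lower_central0 : lower_central L m.+3 = [set 0].
Proof.
apply: zspan_set1 => _ [p _ [q Lq <-]].
have : layer m.+3 (lie p q) by apply: layerS_lie => //; apply: lower_central_thread.
case=> tpq _ wpq ypq zpq; apply: thread_eq => //; first by apply: wpq.
  by move=> j; rewrite yc0; apply: ypq; lia.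
by move=> j; rewrite zc0; apply: zpq; lia.
Qed.

(** Elements of the derived subring have no t-part and an isotropic [W]-part, which kills every term
    of the bracket. *)
Lemma thread_metabelian : metabelian L.
Proof.
apply: zspan_set1 => _ [p Dp [q Dq <-]].
have Dlayer : derived L `<=` layer 2 by exact: (@lower_central_thread 2).
have [tp [y wp] _ _ _] := Dlayer _ Dp; have [tq [y' wq] _ _ _] := Dlayer _ Dq.
rewrite lie_threadE; apply: thread_eq => [//||j|[|j]].
- by rewrite wc_lie tp tq !mulr0z subrr raddf0.
- by rewrite yc_lie tp tq !mulr0z subrr yc0.
- by rewrite zc_lie0 // tp tq wp wq om_iota !mulr0z subrr addr0 zc0.
- by rewrite zc_lieS // tp tq wp wq !om_iota !mulr0z !subrr addr0 zc0.
Qed.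

Definition thread_t : L := mk_thread m 1 (0 : W) (fun=> 0 : Y) (fun=> 0 : C).
Definition thread_w (w : W) : L := mk_thread m 0 w (fun=> 0 : Y) (fun=> 0 : C).
Definition thread_y (i : nat) (y : Y) : L :=
  mk_thread m 0 (0 : W) (fun j => if j == i then y else 0) (fun=> 0 : C).
Definition thread_z (c : C) : L :=
  mk_thread m 0 (0 : W) (fun=> 0 : Y) (fun j => if j == 0%N then c else 0).

Lemma thread_w_is_zmod_morphism : zmod_morphism thread_w.
Proof.
move=> u v; apply: thread_eq => // j.
  by rewrite ycB /yc !fentry_finfun if_same subrr.
by rewrite zcB /zc !fentry_finfun if_same subrr.
Qed.
HB.instance Definition _ :=
  GRing.isZmodMorphism.Build W L thread_w thread_w_is_zmod_morphism.

Lemma thread_z_is_zmod_morphism : zmod_morphism thread_z.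
Proof.
move=> c d; apply: thread_eq => [//||j|j]; first exact: (esym (subrr (0 : W))).
  by rewrite ycB /yc !fentry_finfun if_same subrr.
rewrite zcB /zc !fentry_finfun; case: ifP => _; last by rewrite subrr.
by case: ifP => _; rewrite ?subrr.
Qed.
HB.instance Definition _ :=
  GRing.isZmodMorphism.Build C L thread_z thread_z_is_zmod_morphism.

Lemma thread_z_eq0 c : thread_z c = 0 -> c = 0.
Proof. by move/(congr1 (fun p => zc p 0)); rewrite zc0 /zc fentry_finfun. Qed.

Lemma lie_thread_w u v : lie (thread_w u) (thread_w v) = thread_z (om u v).
Proof.
apply: thread_eq => [//||j|[|j]]; rewrite lie_threadE.
- by rewrite wc_lie !mulr0z subrr raddf0.
- by rewrite yc_lie !mulr0z subrr /yc fentry_finfun if_same.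
- by rewrite zc_lie0 // !mulr0z subrr addr0 /zc fentry_finfun.
- rewrite zc_lieS // !mulr0z subrr addr0 /yc /zc !fentry_finfun !if_same.
  by rewrite !raddf0 addr0.
Qed.

Lemma lie_thread_ty i y : (i.+1 < m)%N -> lie thread_t (thread_y i.+1 y) = thread_y i y.
Proof.
move=> im; apply: thread_eq => [//||j|[|j]]; rewrite lie_threadE.
- by rewrite wc_lie /yc !fentry_finfun /= if_same mulr0z mul0rz subrr raddf0.
- rewrite yc_lie /yc !fentry_finfun eqSS if_same mul0rz subr0 mulr1z.
  case: (j =P i) => [->|]; last by rewrite !if_same.
  by rewrite im ltnW.
- by rewrite zc_lie0 // /zc !fentry_finfun !if_same raddf0 !mul0rz subrr addr0.
- rewrite zc_lieS // /zc !fentry_finfun !if_same !mul0rz.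
  by rewrite !(om0l omDl) !subrr addr0.
Qed.

Lemma lie_thread_ty0 y : (0 < m)%N -> lie thread_t (thread_y 0 y) = thread_w (iota y).
Proof.
move=> m0; apply: thread_eq => [//||j|[|j]]; rewrite lie_threadE.
- by rewrite wc_lie /yc !fentry_finfun m0 /= mulr1z mul0rz subr0.
- by rewrite yc_lie /yc !fentry_finfun /= !if_same !mul0rz subrr.
- by rewrite zc_lie0 // /zc !fentry_finfun !if_same raddf0 !mul0rz subrr addr0.
- rewrite zc_lieS // /zc !fentry_finfun !if_same !mul0rz.
  by rewrite !(om0l omDl) !subrr addr0.
Qed.

(** From the top entry m-1, of degree 1, m brackets with t lead down to [iota y], each adding one to
    the degree. *)
Lemma lie_dim_thread_iota y : lie_dim L m.+1 (thread_w (iota y)).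
Proof.
have [m0|m0] := posnP m.
  have -> : m.+1 = 1%N by rewrite m0.
  exact: lie_dim1.
suff dimy i : (i < m)%N -> lie_dim L i.+1 (thread_y (m - i.+1) y).
  have := dimy m.-1; rewrite prednK // subnn => /(_ (leqnn m)) dim0.
  rewrite -lie_thread_ty0 //.
  exact: (@lie_dim_lie L 1 m _ _ (lie_dim1 _) dim0).
elim: i => [_|i IHi im]; first exact: lie_dim1.
have {}IHi := IHi (ltnW im); rewrite -(subnSK im) in IHi.
rewrite -lie_thread_ty; last by lia.
exact: (@lie_dim_lie L 1 i.+1 _ _ (lie_dim1 _) IHi).
Qed.

(** Carries a configuration in [W] over to the thread ring; the resulting element is nonzero because
    [thread_z] is injective. *)
Lemma thread_lie_dim_neq0 i j k e2 e3 (a1 a2 a3 : W) (y2 y3 z2 z3 : Y) :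
    a2 *+ e2 = iota y2 -> a3 *+ e3 = iota y3 ->
    a2 *+ i + a3 *+ j = 0 ->
    a3 *+ k - a1 *+ i = iota z2 *+ e2 ->
    - (a1 *+ j) - a2 *+ k = iota z3 *+ e3 ->
    om a1 a2 *+ i + om a1 a3 *+ j + om a2 a3 *+ k != 0 ->
  lie_dim L (m.+1 + m.+1) <> [set 0].
Proof.
move=> a2E a3E w1 w2 w3 /eqP c_neq0 dim0; apply/c_neq0/thread_z_eq0.
rewrite !raddfD /= !(raddfMn thread_z) /= -!lie_thread_w.
have : lie_dim L (m.+1 + m.+1) (lie (thread_w a1) (thread_w a2) *+ i
    + lie (thread_w a1) (thread_w a3) *+ j + lie (thread_w a2) (thread_w a3) *+ k).
  apply: (@lie_dim_rips _ _ _ _ _ e2 e3 _ _ _ (thread_w (iota z2)) (thread_w (iota z3))).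
  - by rewrite -!(raddfMn thread_w) -raddfD w1 raddf0.
  - by rewrite -!(raddfMn thread_w) -raddfB w2.
  - by rewrite -!(raddfMn thread_w) -raddfN -raddfB w3.
  - by rewrite -(raddfMn thread_w) /= a2E; exact: lie_dim_thread_iota.
  - by rewrite -(raddfMn thread_w) /= a3E; exact: lie_dim_thread_iota.
  - exact: lie_dim_thread_iota.
  - exact: lie_dim_thread_iota.
by rewrite dim0.
Qed.

End ThreadSeries.

(** * Multiplication maps between residue rings *)

Section ScaledResidues.
Local Open Scope ring_scope.
Variables (p q k : nat) (dvd_kp : (q.+2 %| k * p.+2)%N).

(** The divisibility makes multiplication by [k] well defined on residues; its proof is an argument
    so that the additive structure can be attached to the function. *)
Definition scale_residue of (q.+2 %| k * p.+2)%N :=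
  fun x : 'I_p.+2 => inZp (k * x) : 'I_q.+2.
Local Notation scale := (scale_residue dvd_kp).

Lemma scale_residue_is_zmod_morphism : zmod_morphism scale.
Proof.
have modk n : k * (n %% p.+2) = k * n %[mod q.+2].
  have /dvdnP[c kp] := dvd_kp.
  by rewrite [in RHS](divn_eq n p.+2) mulnDr mulnCA kp mulnA modnMDl.
have scaleD x y : scale (x + y) = scale x + scale y.
  by apply: val_inj; rewrite /= modnDm -mulnDr modk.
by move=> x y; apply: (addIr (scale y)); rewrite -scaleD !subrK.
Qed.

HB.instance Definition _ := GRing.isZmodMorphism.Build 'I_p.+2 'I_q.+2
  scale scale_residue_is_zmod_morphism.

End ScaledResidues.

(** * Alternating forms and isotropic spans *)

Section SymplecticForm.
Local Open Scope ring_scope.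
Variables (R S : comNzRingType) (phi : {additive S -> R}).
Local Notation V := (R * R * S * S)%type.
Implicit Types u v w : V.

(** Orthogonal sum of two hyperbolic planes, over [R] and over [S], the second with values carried
    to [R] by [phi]. *)
Definition sform u v : R :=
  u.1.1.1 * v.1.1.2 - u.1.1.2 * v.1.1.1 + phi (u.1.2 * v.2 - u.2 * v.1.2).

Lemma sformDl u v w : sform (u + v) w = sform u w + sform v w.
Proof.
rewrite /sform addrACA -raddfD /=; congr (_ + phi _).
  by rewrite !mulrDl opprD addrACA.
by rewrite !mulrDl opprD addrACA.
Qed.

Lemma sformC u v : sform u v = - sform v u.
Proof.
rewrite /sform opprD -raddfN !opprB /=; congr (_ - _ + phi (_ - _)); exact: mulrC.
Qed.

Lemma sform_is_zmod_morphism u : zmod_morphism (sform u).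
Proof.
move=> v w; apply: (addIr (sform u w)); rewrite subrK.
by rewrite sformC [sform u w]sformC -opprD -sformDl subrK -sformC.
Qed.
HB.instance Definition _ u :=
  GRing.isZmodMorphism.Build V R (sform u) (sform_is_zmod_morphism u).

Lemma sformww w : sform w w = 0.
Proof. by rewrite /sform mulrC subrr [w.1.2 * _]mulrC subrr raddf0 addr0. Qed.

Definition span3 (u v w : V) (y : int * int * int) : V :=
  u *~ y.1.1 + v *~ y.1.2 + w *~ y.2.

Lemma span3_is_zmod_morphism u v w : zmod_morphism (span3 u v w).
Proof.
by move=> x y; rewrite /span3 /= !mulrzBr opprD [RHS]addrACA opprD [X in _ = X + _]addrACA.
Qed.
HB.instance Definition _ u v w :=
  GRing.isZmodMorphism.Build _ V (span3 u v w) (span3_is_zmod_morphism u v w).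

Lemma sform_span3 u v w x y : sform u v = 0 -> sform u w = 0 -> sform v w = 0 ->
  sform (span3 u v w x) (span3 u v w y) = 0.
Proof.
move=> uv uw vw.
have vu : sform v u = 0 by rewrite sformC uv oppr0.
have wu : sform w u = 0 by rewrite sformC uw oppr0.
have wv : sform w v = 0 by rewrite sformC vw oppr0.
have span0 t z : sform t u = 0 -> sform t v = 0 -> sform t w = 0 ->
    sform t (span3 u v w z) = 0.
  by move=> tu tv tw; rewrite !raddfD /= !(raddfMz (sform t)) /= tu tv tw !mul0rz !addr0.
by rewrite span0 // sformC span0 ?oppr0 ?sformww.
Qed.

End SymplecticForm.

(** * The concrete space and its isotropic subgroup *)

Section RipsSpace.
Local Open Scope ring_scope.

Local Notation W := ('Z_256 * 'Z_256 * 'Z_16 * 'Z_16)%type.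

Definition scale16 : {additive 'Z_16 -> 'Z_256} :=
  @scale_residue 14 254 16 (dvdnn 256).

Definition rips_form (w : W) : {additive W -> 'Z_256} := sform scale16 w.

(* The three generators [a_i] satisfy [rips_form a1 a2 = 1], [rips_form a1 a3 = 2]
   and [rips_form a2 a3 = 4]. *)
Definition rips1 : W := (1, 0, 0, 0).
Definition rips2 : W := (0, 1, 0, 0).
Definition rips3 : W := (- 4, 2, 1, 0).

(** The generators are u2, u3 and v2. The last coordinate of v2 makes it orthogonal to [rips3]: the
    two planes contribute -16 and 16. Also u2 and u3 pair to 16 * 4 * 4 = 256, which is 0. *)
Definition rips_iota : {additive int * int * int -> W} :=
  span3 (rips2 *+ 16) (rips3 *+ 4) (0, 4, 0, 1).

Lemma rips_formDl u v w : rips_form (u + v) w = rips_form u w + rips_form v w.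
Proof. exact: sformDl. Qed.

Lemma rips_formww w : rips_form w w = 0.
Proof. exact: sformww. Qed.

Lemma rips_form_iota x y : rips_form (rips_iota x) (rips_iota y) = 0.
Proof. by apply: sform_span3; apply/eqP; vm_compute. Qed.

End RipsSpace.

Theorem mainTheorem3 (n : nat) (hn : (5 <= n)%N) :
  exists L : lieRingType,
    [/\ metabelian L,
        lower_central L n = [set 0%R]%classic
      & lie_dim L (2 * n - 4) <> [set 0%R]%classic].
Proof.
pose m := (n - 3)%N.
pose L := thread_ring rips_formDl rips_formww rips_form_iota m.
exists L; split; first exact: thread_metabelian.
  by rewrite (_ : n = m.+3); [exact: thread_lower_central0 | lia].
rewrite (_ : 2 * n - 4 = m.+1 + m.+1); last lia.
(* Here v2 = (0, 4, 0, 1) and v3 = u3 - 4 v2 = (-16, -8, 4, -4). The form gives 128 * 1 + 64 * 2 +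
   32 * 4 = 384, which is 128 modulo 256. *)
apply: (thread_lie_dim_neq0 (i := 128) (j := 64) (k := 32) (e2 := 16) (e3 := 4)
    (a1 := rips1) (a2 := rips2) (a3 := rips3) (y2 := (1, 0, 0)%R) (y3 := (0, 1, 0)%R)
    (z2 := (0, 0, 1)%R) (z3 := (0, 1, - 4)%R)); last by vm_compute.
all: by apply/eqP; vm_compute.
Qed.
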